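(* Let $p$ be a prime and $q$ a power of $p$. For every integer $n\ge 1$, the group $\mathrm{SL}(2n+1,\overline{\mathbb{F}_q})$ is not acceptable.
   Context: $\overline{\mathbb{F}_q}$ denotes an algebraic closure of the finite field $\mathbb{F}_q$, and $\mathrm{SL}(k,\overline{\mathbb{F}_q})$ is the group of $k\times k$ matrices of determinant $1$ over it. Let $\Gamma$ be a group and $H$ a finite group. Two homomorphisms $\phi_1,\phi_2:H\to\Gamma$ are element-conjugate if for every $x\in H$ there is $h(x)\in\Gamma$ with $\phi_1(x)=h(x)^{-1}\phi_2(x)h(x)$; they are globally conjugate if one can choose a single $h\in\Gamma$ with $\phi_1(x)=h^{-1}\phi_2(x)h$ for all $x\in H$. The group $\Gamma$ is acceptable if for every finite group $H$, any two element-conjugate homomorphisms $H\to\Gamma$ are globally conjugate. *)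

(* Defs.v *)
From HB Require Import structures.
From mathcomp Require Import all_boot all_order all_algebra all_fingroup.

Set Implicit Arguments.
Unset Strict Implicit.
Unset Printing Implicit Defensive.

Import GRing.Theory.

(* SL k R is an infinite group in general, so it is built as a [groupType] on
   a subtype of the matrices. The matrix product [*m] is used rather than the
   ring structure, since ['M[R]_k] is a unit ring only for k of the form k'.+1. *)
Section SpecialLinear.

Local Open Scope ring_scope.

Variables (k : nat) (R : comUnitRingType).

Record SL := MkSL { SLval :> 'M[R]_k; SL_det : \det SLval == 1 }.

HB.instance Definition _ := [isSub for SLval].
HB.instance Definition _ := [Choice of SL by <:].

Implicit Types A B : SL.

Fact SL_one_proof : \det (1%:M : 'M[R]_k) == 1.
Proof. by rewrite det1. Qed.

Fact SL_mul_proof A B : \det (A *m B) == 1.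
Proof. by rewrite det_mulmx (eqP (SL_det A)) (eqP (SL_det B)) mul1r. Qed.

Fact SL_inv_proof A : \det (invmx A) == 1.
Proof. by rewrite det_inv (eqP (SL_det A)) invr1. Qed.

Definition SL_one := MkSL SL_one_proof.
Definition SL_mul A B := MkSL (SL_mul_proof A B).
Definition SL_inv A := MkSL (SL_inv_proof A).

Fact SL_unitmx A : SLval A \in unitmx.
Proof. by rewrite unitmxE (eqP (SL_det A)) unitr1. Qed.

Fact SL_mulA : associative SL_mul.
Proof. by move=> A B C; apply: val_inj; rewrite /= mulmxA. Qed.

Fact SL_mul1 : left_id SL_one SL_mul.
Proof. by move=> A; apply: val_inj; rewrite /= mul1mx. Qed.

Fact SL_mulr1 : right_id SL_one SL_mul.
Proof. by move=> A; apply: val_inj; rewrite /= mulmx1. Qed.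

Fact SL_mulV : left_inverse SL_one SL_inv SL_mul.
Proof. by move=> A; apply: val_inj; rewrite /= mulVmx ?SL_unitmx. Qed.

Fact SL_mulrV : right_inverse SL_one SL_inv SL_mul.
Proof. by move=> A; apply: val_inj; rewrite /= mulmxV ?SL_unitmx. Qed.

HB.instance Definition _ :=
  isGroup.Build SL SL_mulA SL_mul1 SL_mulr1 SL_mulV SL_mulrV.

End SpecialLinear.

Section Acceptability.

Local Open Scope group_scope.

(* Here x ^ h is the conjugate h^-1 * x * h. *)
Definition element_conjugate (H : finGroupType) (Gamma : groupType)
    (phi1 phi2 : H -> Gamma) : Prop :=
  forall x : H, exists h : Gamma, phi1 x = phi2 x ^ h.

Definition globally_conjugate (H : finGroupType) (Gamma : groupType)
    (phi1 phi2 : H -> Gamma) : Prop :=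
  exists h : Gamma, forall x : H, phi1 x = phi2 x ^ h.

Definition acceptable (Gamma : groupType) : Prop :=
  forall (H : finGroupType) (phi1 phi2 : {multiplicative H -> Gamma}),
    element_conjugate phi1 phi2 -> globally_conjugate phi1 phi2.

End Acceptability.

(* With K closed, this makes K, through iota, an algebraic closure of F. *)
Definition is_algebraic_closure (F : fieldType) (K : closedFieldType)
    (iota : {rmorphism F -> K}) : Prop :=
  forall z : K, algebraicOver iota z.

(* Main.v *)
Require Import Defs.
From HB Require Import structures.
From mathcomp Require Import all_boot all_order all_algebra all_fingroup.

(** The failure of acceptability is witnessed by the additive group [F ^ d] of
    row vectors over a finite subfield [F] of [K], where [d >= 2]. It acts on
    the [1 + d]-dimensional space through the two block matrices

      [v |-> (1 v; 0 1)]   and   [v |-> (1 0; v^T 1)].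

    Both are homomorphisms, because [1 + N] and [1 + N'] multiply by adding
    [N] and [N'] as soon as [N N' = 0].

    Element by element they agree up to conjugation, since a matrix is always
    similar to its transpose: for [v <> 0] both images are transvections. The
    conjugating matrix can be taken symmetric with first row [(0 v)]
    ([swap_mx]), and it can be rescaled to have determinant 1 because [K] is
    closed ([SL_conjugate_of_GL]).

    No single matrix conjugates the two homomorphisms: on column vectors the
    first has a fixed space of dimension 1 (the line of the first basis vector)
    while the second has one of dimension [d >= 2]. Concretely, an intertwiner
    [h] sends the first basis vector, fixed by the first image, to a vector
    fixed by the second, hence with zero first coordinate; and if [d >= 2] the
    intertwining relations force its other coordinates to vanish as well, so
    the first column of [h] is zero and [h] is singular
    ([intertwiner_singular]). *)

(** * Conjugation in the special linear group *)

Section Conjugation.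

Set Implicit Arguments.
Unset Strict Implicit.
Unset Printing Implicit Defensive.

Import GRing.Theory.
Local Open Scope ring_scope.

Lemma SL_conjP (m : nat) (R : comUnitRingType) (A B g : SL m R) :
  A = (B ^ g)%g <-> SLval g *m A = SLval B *m g.
Proof.
split=> [-> | gA]; first by have /(congr1 val) := conjgC B g.
by apply: (mulgI g); rewrite -conjgC; apply: val_inj.
Qed.

(** Over a closed field every scalar is an [m]-th power, so the determinant of
    an invertible intertwiner can be normalized by a scalar factor, which does
    not affect conjugation. *)
Lemma SL_conjugate_of_GL (m : nat) (K : closedFieldType) (A B : SL m K)
    (h : 'M[K]_m) :
    (0 < m)%N -> \det h != 0 -> h *m A = SLval B *m h ->
  exists g : SL m K, A = (B ^ g)%g.
Proof.
move=> m_gt0 h_neq0 hAB.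
have [c c_m] := solve_monicpoly (fun i => (\det h)^-1 *+ (i == 0)%N) m_gt0.
have det_ch : \det (c *: h) == 1.
  rewrite detZ c_m (bigD1 (Ordinal m_gt0)) //= big1 => [|i /negPf i_neq0].
    by rewrite addr0 expr0 mulr1 mulVf.
  have -> : (i == 0 :> nat) = false by rewrite -i_neq0.
  by rewrite mulr0n mul0r.
exists (MkSL det_ch); apply/SL_conjP.
by rewrite /= -scalemxAl hAB scalemxAr.
Qed.

End Conjugation.

(** * Two transposed unipotent representations *)

Section Transvections.

Set Implicit Arguments.
Unset Strict Implicit.
Unset Printing Implicit Defensive.

Import GRing.Theory.
Local Open Scope ring_scope.

Variables (K : fieldType) (d : nat).
Implicit Types v w : 'rV[K]_d.

Definition row_unipotent v : 'M[K]_(1 + d) := block_mx 1%:M v 0 1%:M.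
Definition col_unipotent v : 'M[K]_(1 + d) := block_mx 1%:M 0 v^T 1%:M.

Lemma det_row_unipotent v : \det (row_unipotent v) == 1.
Proof. by rewrite det_ublock !det1 mulr1. Qed.

Lemma det_col_unipotent v : \det (col_unipotent v) == 1.
Proof. by rewrite det_lblock !det1 mulr1. Qed.

Lemma row_unipotentD v w :
  row_unipotent (v + w) = row_unipotent v *m row_unipotent w.
Proof.
by rewrite mulmx_block !(mul0mx, mulmx0, mul1mx, mulmx1, addr0, add0r) addrC.
Qed.

Lemma col_unipotentD v w :
  col_unipotent (v + w) = col_unipotent v *m col_unipotent w.
Proof.
rewrite mulmx_block !(mul0mx, mulmx0, mul1mx, mulmx1, addr0, add0r).
by rewrite -linearD.
Qed.

(** Any symmetric matrix with first row [(0 v)] intertwines the two images of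
    [v]; the lower right block is the projection along the [j]-th axis, which
    makes the matrix invertible when [v 0 j != 0]. *)
Definition swap_mx v (j : 'I_d) : 'M[K]_(1 + d) :=
  block_mx 0 v v^T (1%:M - delta_mx j j).

Lemma swap_mx_intertwines v j :
  swap_mx v j *m row_unipotent v = col_unipotent v *m swap_mx v j.
Proof.
by rewrite !mulmx_block !(mul0mx, mulmx0, mul1mx, mulmx1, addr0, add0r).
Qed.

Lemma det_swap_mx_neq0 v j : v 0 j != 0 -> \det (swap_mx v j) != 0.
Proof.
move=> vj; apply/det0P => -[u /eqP u_neq0 uS]; case: u_neq0; move: uS.
rewrite -[u]hsubmxK; move: (lsubmx u) (rsubmx u) => a w.
rewrite mul_row_block mulmx0 add0r -[0]row_mx0 => /eq_row_mx [wv avw].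
have aE : a = (a 0 0)%:M by rewrite [LHS]mx11_scalar.
have w_delta i : (w *m delta_mx j j) 0 i = w 0 j *+ (i == j).
  rewrite mxE (bigD1 j) //= big1 => [|k /negPf kj].
    by rewrite mxE eqxx addr0 mulr_natr.
  by rewrite mxE kj mulr0.
have coord i : a 0 0 * v 0 i + (w 0 i - w 0 j *+ (i == j)) = 0.
  move/rowP/(_ i): avw; rewrite mulmxBr mulmx1 aE mul_scalar_mx.
  by rewrite !mxE mulr1n -w_delta !mxE.
have a0 : a 0 0 = 0.
  have /eqP := coord j; rewrite eqxx mulr1n subrr addr0 mulf_eq0 (negPf vj).
  by rewrite orbF => /eqP.
have w_off i : i != j -> w 0 i = 0.
  move=> /negPf ij; have := coord i.
  by rewrite a0 mul0r add0r ij mulr0n subr0.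
have wj : w 0 j = 0.
  move/rowP/(_ 0): wv; rewrite !mxE (bigD1 j) //= big1 ?addr0 => [|k kj].
    by rewrite mxE => /eqP; rewrite mulf_eq0 (negPf vj) orbF => /eqP.
  by rewrite w_off // mul0r.
rewrite aE a0 raddf0.
suff -> : w = 0 by rewrite row_mx0.
by apply/rowP => i; rewrite !mxE; have [-> | /w_off] := eqVneq i j.
Qed.

(** With [h = (a b; c D)], the intertwining relation for [v] says that
    [a v = 0] and that [c v = v^T b]. For the [i]-th basis vector the [k]-th
    row of the latter reads [c_k = 0] in column [i] if [k != i]; such an [i]
    exists for every [k] because [d >= 2]. *)
Lemma intertwiner_singular (h : 'M[K]_(1 + d)) :
    (1 < d)%N ->
    (forall i, h *m row_unipotent (delta_mx 0 i)
                 = col_unipotent (delta_mx 0 i) *m h) ->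
  \det h = 0.
Proof.
move=> d_gt1; rewrite -[h]submxK.
move: (ulsubmx h) (ursubmx h) (dlsubmx h) (drsubmx h) => a b c D rel.
have rels i : a *m delta_mx 0 i = 0
    /\ c *m delta_mx 0 i = (delta_mx 0 i)^T *m b.
  have := rel i; rewrite !mulmx_block.
  rewrite !(mul0mx, mulmx0, mul1mx, mulmx1, addr0, add0r).
  case/eq_block_mx => _ /eqP ab _ /eqP cD; split.
    by move: ab; rewrite -subr_eq0 addrK => /eqP.
  by move: cD; rewrite (inj_eq (addIr D)) => /eqP.
pose i0 : 'I_d := Ordinal (ltnW d_gt1).
have a0 : a = 0.
  apply/matrixP => x y; rewrite !ord1.
  have [/matrixP/(_ 0 i0) + _] := rels i0.
  by rewrite !mxE big_ord1 mxE !eqxx mulr1.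
have c0 : c = 0.
  apply/matrixP => k x; rewrite ord1 [RHS]mxE.
  have [i ik] : exists i : 'I_d, k != i.
    have [->|ki0] := eqVneq k i0; last by exists i0.
    by exists (Ordinal d_gt1).
  have [_ /matrixP/(_ k i)] := rels i.
  rewrite !mxE !big_ord1 !mxE !eqxx mulr1 => ->.
  by rewrite (negPf ik) mul0r.
by rewrite a0 c0 det_ublock det0 mul0r.
Qed.

End Transvections.

(** * The two homomorphisms *)

Section Homomorphisms.

Set Implicit Arguments.
Unset Strict Implicit.
Unset Printing Implicit Defensive.

Import GRing.Theory.
Local Open Scope ring_scope.

Variables (F : finFieldType) (K : fieldType) (iota : {rmorphism F -> K}).
Variable d : nat.

Definition row_rep (v : 'rV[F]_d) : SL (1 + d) K :=
  MkSL (det_row_unipotent (map_mx iota v)).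
Definition col_rep (v : 'rV[F]_d) : SL (1 + d) K :=
  MkSL (det_col_unipotent (map_mx iota v)).

Fact row_rep_morph : {morph row_rep : v w / (v * w)%g}.
Proof. by move=> v w; apply: val_inj; rewrite /= map_mxD row_unipotentD. Qed.

Fact col_rep_morph : {morph col_rep : v w / (v * w)%g}.
Proof. by move=> v w; apply: val_inj; rewrite /= map_mxD col_unipotentD. Qed.

HB.instance Definition _ :=
  isMultiplicative.Build 'rV[F]_d (SL (1 + d) K) row_rep row_rep_morph.
HB.instance Definition _ :=
  isMultiplicative.Build 'rV[F]_d (SL (1 + d) K) col_rep col_rep_morph.

Lemma row_col_not_globally_conjugate :
  (1 < d)%N -> ~ globally_conjugate row_rep col_rep.
Proof.
move=> d_gt1 [h conj_h].
have/eqP := SL_det h; rewrite intertwiner_singular // => [/eqP|i].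
  by rewrite eq_sym oner_eq0.
have /SL_conjP := conj_h (delta_mx 0 i).
by rewrite /= map_delta_mx.
Qed.

End Homomorphisms.

Section NotAcceptable.

Set Implicit Arguments.

Import GRing.Theory.
Local Open Scope ring_scope.

Lemma row_col_element_conjugate (F : finFieldType) (K : closedFieldType)
    (iota : {rmorphism F -> K}) (d : nat) :
  element_conjugate (row_rep iota (d:=d)) (col_rep iota (d:=d)).
Proof.
move=> v; have [-> | /rV0Pn [j vj]] := eqVneq v 0.
  exists 1%g; rewrite conjg1; apply: val_inj.
  by rewrite /= map_mx0 /row_unipotent /col_unipotent trmx0.
apply: (@SL_conjugate_of_GL _ _ _ _ (swap_mx (map_mx iota v) j)) => //.
  by apply: det_swap_mx_neq0; rewrite mxE fmorph_eq0.
exact: swap_mx_intertwines.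
Qed.

Lemma SL_not_acceptable (F : finFieldType) (K : closedFieldType)
    (iota : {rmorphism F -> K}) (d : nat) :
  (1 < d)%N -> ~ acceptable (SL (1 + d) K).
Proof.
move=> d_gt1 acc.
apply: (@row_col_not_globally_conjugate F K iota d d_gt1).
by apply: (acc 'rV[F]_d (row_rep iota (d:=d)) (col_rep iota (d:=d)));
  apply: row_col_element_conjugate.
Qed.

End NotAcceptable.

Theorem corollary4p4 (p q e : nat) (hp : prime p) (he : 0 < e) (hq : q = p ^ e)
    (Fq : finFieldType) (hFq : #|Fq| = q)
    (K : closedFieldType) (iota : {rmorphism Fq -> K})
    (hK : is_algebraic_closure iota)
    (n : nat) (hn : 1 <= n) :
  ~ acceptable (SL (2 * n + 1) K).
Proof.
rewrite addnC; apply: (@SL_not_acceptable _ _ iota (2 * n)).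
exact: (@leq_mul 2 1 2 n).
Qed.
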